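(* Let $K_n$ be the complete graph on $n$ vertices. Then the cartesian product $K_n\times K_2$ satisfies $$E_R(K_n\times K_2)=\frac{10n^2+4n-8}{n(n+2)}.$$
   Context: For a connected graph $G$ with vertices $v_1,\dots,v_m$, Laplacian matrix $L$ (degree matrix minus adjacency matrix) and Moore-Penrose inverse $L^\dagger=(l^\dagger_{ij})$, the resistance distance is $r_{ij}=l^\dagger_{ii}+l^\dagger_{jj}-2l^\dagger_{ij}$, and the resistance distance matrix is $R(G)=(r_{ij})_{m\times m}$. The resistance energy $E_R(G)$ is the sum of the absolute values of the eigenvalues of $R(G)$, counted with multiplicity. The cartesian product $G_1\times G_2$ has vertex set $V(G_1)\times V(G_2)$, with $(v_1,u_1)$ and $(v_2,u_2)$ adjacent if $v_1=v_2$ and $u_1u_2\in E(G_2)$, or $u_1=u_2$ and $v_1v_2\in E(G_1)$. *)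

(* Defs.v *)
From HB Require Import structures.
From mathcomp Require Import all_boot all_order all_algebra.
From mathcomp Require Import reals complex.

Set Implicit Arguments.
Unset Strict Implicit.
Unset Printing Implicit Defensive.

Import Order.TTheory GRing.Theory Num.Theory.
Local Open Scope ring_scope.

Record sgraph (V : finType) := SGraph {
  adj :> rel V;
  adj_sym : symmetric adj;
  adj_irrefl : irreflexive adj }.

Definition graph_connected (V : finType) (G : sgraph V) :=
  forall x y : V, connect G x y.

Section CompleteGraph.
Variable n : nat.

Definition complete_adj : rel 'I_n := fun i j => i != j.

Lemma complete_sym : symmetric complete_adj.
Proof. by move=> i j; rewrite /complete_adj eq_sym. Qed.

Lemma complete_irrefl : irreflexive complete_adj.
Proof. by move=> i; rewrite /complete_adj eqxx. Qed.

Definition complete_graph := SGraph complete_sym complete_irrefl.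

End CompleteGraph.

Section CartesianProduct.
Variables (V1 V2 : finType) (G1 : sgraph V1) (G2 : sgraph V2).

Definition cart_adj : rel (V1 * V2)%type := fun p q =>
  ((p.1 == q.1) && G2 p.2 q.2) || ((p.2 == q.2) && G1 p.1 q.1).

Lemma cart_sym : symmetric cart_adj.
Proof.
move=> p q; rewrite /cart_adj (adj_sym G1) (adj_sym G2).
by rewrite (eq_sym p.1) (eq_sym p.2).
Qed.

Lemma cart_irrefl : irreflexive cart_adj.
Proof. by move=> p; rewrite /cart_adj !adj_irrefl !andbF. Qed.

Definition cart_graph := SGraph cart_sym cart_irrefl.

End CartesianProduct.

Lemma cart_complete_connected m n :
  graph_connected (cart_graph (complete_graph m) (complete_graph n)).
Proof.
move=> [a b] [c d]; apply: (@connect_trans _ _ (c, b)).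
  have [->|ac] := eqVneq a c; first exact: connect0.
  by apply: connect1; rewrite /= /cart_adj /= /complete_adj eqxx ac orbT.
have [->|bd] := eqVneq b d; first exact: connect0.
by apply: connect1; rewrite /= /cart_adj /= /complete_adj eqxx bd.
Qed.

(* The scalars are real, so the conjugate transposes in the Penrose equations
   are plain transposes. *)
Section MoorePenrose.
Variable R : realFieldType.

Definition is_mpinv m n (A : 'M[R]_(m, n)) (X : 'M[R]_(n, m)) : bool :=
  [&& A *m X *m A == A, X *m A *m X == X,
      (A *m X)^T == A *m X & (X *m A)^T == X *m A].

Lemma mulmx_tr_eq0 m n (v : 'M[R]_(m, n)) : v *m v^T = 0 -> v = 0.
Proof.
move=> v0; apply/matrixP => i j; rewrite mxE; apply/eqP.
have /matrixP/(_ i i) := v0; rewrite !mxE => /eqP.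
rewrite psumr_eq0 => [|k _]; last by rewrite mxE -expr2 sqr_ge0.
by move=> /allP/(_ j (mem_index_enum _)) /=; rewrite mxE mulf_eq0 orbb.
Qed.

Lemma gram_unit m n (B : 'M[R]_(m, n)) : row_free B -> B *m B^T \in unitmx.
Proof.
move=> fB; rewrite -row_free_unit -kermx_eq0; apply/eqP.
set K := kermx _.
have K0 : K *m (B *m B^T) = 0 by rewrite mulmx_ker.
apply: (row_free_inj fB); rewrite mul0mx; apply: mulmx_tr_eq0.
by rewrite trmx_mul mulmxA -(mulmxA K) K0 mul0mx.
Qed.

Lemma mpinv_factor m r n (C : 'M[R]_(m, r)) (F : 'M[R]_(r, n)) :
  row_full C -> row_free F -> exists X, is_mpinv (C *m F) X.
Proof.
move=> fC fF; have uF := gram_unit fF.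
have uC : C^T *m C \in unitmx.
  by rewrite -[X in _ *m X]trmxK gram_unit // /row_free mxrank_tr.
pose X := F^T *m invmx (F *m F^T) *m (invmx (C^T *m C) *m C^T).
have AX : C *m F *m X = C *m invmx (C^T *m C) *m C^T.
  by rewrite /X !mulmxA -(mulmxA C F) mulmxK.
have XA : X *m (C *m F) = F^T *m invmx (F *m F^T) *m F.
  by rewrite /X !mulmxA -(mulmxA _ C^T C) mulmxKV.
exists X; apply/and4P; split; apply/eqP.
- by rewrite AX !mulmxA -(mulmxA _ C^T C) mulmxKV.
- by rewrite XA /X !mulmxA -(mulmxA _ F F^T) mulmxKV.
- by rewrite AX !trmx_mul trmx_inv !trmx_mul !trmxK mulmxA.
- by rewrite XA !trmx_mul trmx_inv !trmx_mul !trmxK mulmxA.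
Qed.

Lemma mpinv_exists m n (A : 'M[R]_(m, n)) : exists X, is_mpinv A X.
Proof.
have := mpinv_factor (col_base_full A) (row_base_free A).
by rewrite mulmx_base.
Qed.

Lemma mpinv_unique m n (A : 'M[R]_(m, n)) X Y :
  is_mpinv A X -> is_mpinv A Y -> X = Y.
Proof.
case/and4P=> /eqP x1 /eqP x2 /eqP x3 /eqP x4.
case/and4P=> /eqP y1 /eqP y2 /eqP y3 /eqP y4.
have AXY : A *m X = A *m Y.
  rewrite -[LHS]x3 -[in LHS]y1 -(mulmxA (A *m Y)) trmx_mul x3 y3.
  by rewrite mulmxA x1.
have XAY : X *m A = Y *m A.
  rewrite -[LHS]x4 -[in LHS]y1 -(mulmxA A) mulmxA trmx_mul x4 y4.
  by rewrite -mulmxA (mulmxA A) x1.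
by rewrite -x2 XAY -mulmxA AXY mulmxA y2.
Qed.

Definition mpinv m n (A : 'M[R]_(m, n)) : 'M[R]_(n, m) :=
  xchoose (mpinv_exists A).

Lemma mpinvP m n (A : 'M[R]_(m, n)) : is_mpinv A (mpinv A).
Proof. exact: xchooseP. Qed.

End MoorePenrose.

(* Vertices are numbered by their rank in [enum V]. *)
Section Resistance.
Variables (R : realFieldType) (V : finType) (G : sgraph V).

Definition adjacency_mx : 'M[R]_#|V| :=
  \matrix_(i, j) (G (enum_val i) (enum_val j))%:R.

Definition degree (x : V) : nat := #|[set y | G x y]|.

Definition degree_mx : 'M[R]_#|V| :=
  diag_mx (\row_i (degree (enum_val i))%:R).

Definition laplacian : 'M[R]_#|V| := degree_mx - adjacency_mx.

Definition resistance_mx : 'M[R]_#|V| :=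
  \matrix_(i, j) (mpinv laplacian i i + mpinv laplacian j j
                  - 2 * mpinv laplacian i j).

End Resistance.

Section Energy.
Variable R : rcfType.

(* All complex eigenvalues, repeated according to algebraic multiplicity. *)
Definition eigenvalues n (A : 'M[R]_n) : seq R[i] :=
  sval (closed_field_poly_normal (char_poly (map_mx (real_complex R) A))).

Lemma eigenvaluesP n (A : 'M[R]_n) :
  char_poly (map_mx (real_complex R) A)
  = \prod_(z <- eigenvalues A) ('X - z%:P).
Proof.
rewrite /eigenvalues; case: closed_field_poly_normal => s /= {1}->.
by rewrite (monicP (char_poly_monic _)) scale1r.
Qed.

Definition matrix_energy n (A : 'M[R]_n) : R :=
  \sum_(z <- eigenvalues A) ComplexField.Normc.normc z.

Definition resistance_energy (V : finType) (G : sgraph V) : R :=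
  matrix_energy (resistance_mx R G).

End Energy.

(* Main.v *)
Require Import Defs.
From mathcomp Require Import all_boot all_order all_algebra.
From mathcomp Require Import sesquilinear spectral.
From mathcomp Require Import reals complex ring.

(** The idea is to exhibit the common spectral decomposition of the Laplacian,
    of its Moore-Penrose inverse and of the resistance matrix, for the product
    of two complete graphs on n and m vertices.

    On functions on n points, let Q be the projection onto constants (taking
    the mean) and Q' = 1 - Q the complementary one.  Functions on the vertices
    of the product carry the four orthogonal symmetric idempotents
    Q (x) Q, Q' (x) Q, Q (x) Q', Q' (x) Q', which sum to the identity, and the
    Laplacian L acts on their images by 0, n, m, n + m
    ([laplacian_cart_complete]).  Inverting the nonzero eigenvalues gives the
    Moore-Penrose inverse X ([mpinv_resolution]).  All diagonal entries of X
    equal T / (nm), where T is the trace of X, so the resistance matrix is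
    (2T / (nm)) J - 2 X with J the all-ones matrix: it acts by 2T on constants
    and by -2/mu on the part where L acts by mu <> 0
    ([resistance_cart_complete]).

    The energy is then read off the resolution
    ([matrix_energy_resolution]): it is the sum of the absolute eigenvalues
    weighted by the traces of the idempotents, i.e. 2T + 2T = 4T, where
    T = (n-1)(m-1)/(n+m) + (n-1)/n + (m-1)/m.  The case m = 2 is the claim. *)

Set Implicit Arguments.
Unset Strict Implicit.
Unset Printing Implicit Defensive.

Import Order.TTheory GRing.Theory Num.Theory.
Local Open Scope ring_scope.

(** * Energy of a symmetric matrix with a known spectral resolution *)

Lemma char_poly_conj (F : fieldType) n (P D : 'M[F]_n) :
  P \in unitmx -> char_poly (invmx P *m D *m P) = char_poly D.
Proof.
move=> uP; rewrite /char_poly.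
have -> : char_poly_mx (invmx P *m D *m P)
  = map_mx polyC (invmx P) *m char_poly_mx D *m map_mx polyC P.
  rewrite /char_poly_mx mulmxBr mulmxBl -!map_mxM /=; congr (_ - _).
  by rewrite scalar_mxC -mulmxA -map_mxM mulVmx // map_mx1 mulmx1.
rewrite !det_mulmx mulrAC -det_mulmx -map_mxM mulVmx //.
by rewrite map_mx1 det1 mul1r.
Qed.

(** The matrices [P k] need not be idempotent nor the scalars [lam k] distinct:
    in an orthonormal eigenbasis of [A], a row of [P k] is zero or belongs to
    the eigenvalue [lam k], so the sum of the [`|lam k| *: P k] is diagonal in
    that basis, with the absolute eigenvalues of [A] on the diagonal. *)
Lemma matrix_energy_resolution (R : rcfType) n (A : 'M[R]_n) (I : finType)
    (P : I -> 'M[R]_n) (lam : I -> R) :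
  A^T = A -> \sum_k P k = 1%:M -> (forall k, A *m P k = lam k *: P k) ->
  matrix_energy A = \sum_k `|lam k| * \tr (P k).
Proof.
move=> symA sumP AP; pose rc : {rmorphism R -> R[i]} := real_complex R.
pose Ac := map_mx rc A; pose U := spectralmx Ac; pose d := spectral_diag Ac.
have normalA : Ac \is normalmx.
  apply: symmetric_normalmx.
    by apply/is_hermitianmxP; rewrite expr0 scale1r map_mx_id // map_trmx symA.
  by apply/mxOverP => i j; rewrite mxE complex_real.
have AcE : Ac = invmx U *m diag_mx d *m U by apply/orthomx_spectralP.
have uU : U \in unitmx by apply: spectral_unit.
have UA : U *m Ac = diag_mx d *m U by rewrite AcE !mulmxA mulmxV // mul1mx.
have eig : perm_eq (eigenvalues A) [seq d 0 i | i : 'I_n].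
  rewrite prod_XsubC_eq // -eigenvaluesP -/Ac AcE char_poly_conj //.
  rewrite char_poly_trig ?diag_mx_is_trig // big_image /=.
  by apply: eq_bigr => i _; rewrite mxE eqxx mulr1n.
(* Row i of U *m P k vanishes unless d 0 i = lam k. *)
have absP k i j : `|d 0 i| * (U *m map_mx rc (P k)) i j
                = `|rc (lam k)| * (U *m map_mx rc (P k)) i j.
  have := congr1 (fun M => (U *m map_mx rc M) i j) (AP k).
  rewrite /= map_mxM map_mxZ /= mulmxA -/Ac UA -scalemxAr -mulmxA mul_diag_mx.
  rewrite [LHS]mxE [RHS]mxE; move: (_ i j) => u /eqP.
  rewrite -subr_eq0 -mulrBl mulf_eq0 subr_eq0 => /orP[/eqP->//|/eqP->].
  by rewrite !mulr0.
pose B := \sum_k `|lam k| *: P k.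
(* B is the absolute value of A: it is diagonalized by U as well. *)
have UB : U *m map_mx rc B = diag_mx (map_mx Num.norm d) *m U.
  apply/matrixP => i j; rewrite mul_diag_mx [RHS]mxE [X in _ = X * _]mxE.
  rewrite -[in RHS](mulmx1 U) -(map_mx1 rc) -sumP !(map_mx_sum, mulmx_sumr).
  rewrite !summxE mulr_sumr; apply: eq_bigr => k _.
  rewrite absP map_mxZ -scalemxAr [LHS]mxE; congr (_ * _).
  by rewrite normc_def /= expr0n addr0 sqrtr_sqr.
apply: (@complexI R); transitivity (rc (\tr B)); last first.
  congr (rc _); rewrite raddf_sum; apply: eq_bigr => k _.
  by rewrite /= mxtraceZ.
transitivity (\tr (diag_mx (map_mx Num.norm d))).
  rewrite mxtrace_diag -/(rc _) rmorph_sum /=.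
  rewrite (perm_big _ eig) big_image /=.
  by apply: eq_bigr => i _; rewrite mxE.
rewrite -trace_map_mx -(mulKmx uU (map_mx rc B)) UB.
by rewrite [in RHS]mxtrace_mulC mulmxK.
Qed.

(** * Kronecker products indexed by pairs *)

Section Kronecker.
Variables (R : comPzRingType) (m n : nat).
Implicit Types (A : 'M[R]_m) (B : 'M[R]_n).

(** The Kronecker product of [A] and [B], with rows and columns numbered by
    the rank of the pair of indices in its finite type, so that it has the
    type of the matrices attached to a graph on ['I_m * 'I_n]. *)
Definition kmx A B : 'M[R]_#|{: 'I_m * 'I_n}| :=
  \matrix_(i, j) (A (enum_val i).1 (enum_val j).1
                  * B (enum_val i).2 (enum_val j).2).

Lemma sum_enum_pair (f : 'I_m * 'I_n -> R) :
  \sum_(k < #|{: 'I_m * 'I_n}|) f (enum_val k) = \sum_i \sum_j f (i, j).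
Proof.
rewrite pair_bigA /= (reindex (@enum_val _ {: 'I_m * 'I_n})) /=; last first.
  exact/onW_bij/enum_val_bij.
by apply: eq_bigr => k _; case: (enum_val k).
Qed.

Lemma kmxM A B A' B' : kmx A B *m kmx A' B' = kmx (A *m A') (B *m B').
Proof.
apply/matrixP => i j; rewrite !mxE.
under eq_bigr do rewrite !mxE.
rewrite (sum_enum_pair (fun z => A _ z.1 * B _ z.2 * (A' z.1 _ * B' z.2 _))).
rewrite mulr_suml; apply: eq_bigr => k _; rewrite mulr_sumr.
by apply: eq_bigr => l _ /=; rewrite mulrACA.
Qed.

Lemma kmx1 : kmx 1%:M 1%:M = 1%:M.
Proof.
apply/matrixP => i j; rewrite !mxE -(inj_eq enum_val_inj).
by case: (enum_val i) (enum_val j) => a b [c d]; rewrite -natrM mulnb.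
Qed.

Lemma kmxDl A A' B : kmx (A + A') B = kmx A B + kmx A' B.
Proof. by apply/matrixP => i j; rewrite !mxE mulrDl. Qed.

Lemma kmxDr A B B' : kmx A (B + B') = kmx A B + kmx A B'.
Proof. by apply/matrixP => i j; rewrite !mxE mulrDr. Qed.

Lemma kmxZl a A B : kmx (a *: A) B = a *: kmx A B.
Proof. by apply/matrixP => i j; rewrite !mxE mulrA. Qed.

Lemma kmxZr a A B : kmx A (a *: B) = a *: kmx A B.
Proof. by apply/matrixP => i j; rewrite !mxE mulrCA. Qed.

Lemma tr_kmx A B : (kmx A B)^T = kmx A^T B^T.
Proof. by apply/matrixP => i j; rewrite !mxE. Qed.

Lemma mxtrace_kmx A B : \tr (kmx A B) = \tr A * \tr B.
Proof.
rewrite /mxtrace; under eq_bigr do rewrite mxE.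
rewrite (sum_enum_pair (fun z => A z.1 z.1 * B z.2 z.2)) mulr_suml.
by apply: eq_bigr => k _; rewrite mulr_sumr.
Qed.

End Kronecker.

(** * Moore-Penrose inverse from a spectral resolution *)

Section Resolution.
Variables (R : realFieldType) (n : nat) (I : finType) (P : I -> 'M[R]_n).
Hypothesis PP : forall k l, P k *m P l = (k == l)%:R *: P k.

Lemma mulmx_sum_proj (a : I -> R) k :
  (\sum_l a l *: P l) *m P k = a k *: P k.
Proof.
rewrite mulmx_suml (bigD1 k) //= big1 => [|l lk].
  by rewrite addr0 -scalemxAl PP eqxx scale1r.
by rewrite -scalemxAl PP (negPf lk) scale0r scaler0.
Qed.

Lemma mulmx_sum_projs (a b : I -> R) :
  (\sum_k a k *: P k) *m (\sum_k b k *: P k) = \sum_k (a k * b k) *: P k.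
Proof.
rewrite mulmx_sumr; apply: eq_bigr => k _.
by rewrite -scalemxAr mulmx_sum_proj scalerA mulrC.
Qed.

(** Since [0^-1 = 0], inverting the coefficients leaves the kernel alone. *)
Lemma mpinv_resolution (mu : I -> R) :
  (forall k, (P k)^T = P k) ->
  mpinv (\sum_k mu k *: P k) = \sum_k (mu k)^-1 *: P k.
Proof.
move=> symP; apply: mpinv_unique (mpinvP _) _.
have symS a : (\sum_k a k *: P k)^T = \sum_k a k *: P k.
  by rewrite raddf_sum; apply: eq_bigr => k _; rewrite /= linearZ /= symP.
apply/and4P; rewrite !mulmx_sum_projs !symS; split=> //; apply/eqP.
  apply: eq_bigr => k _; have [->|mu0] := eqVneq (mu k) 0.
    by rewrite mulr0.
  by rewrite mulfV // mul1r.
apply: eq_bigr => k _; have [->|mu0] := eqVneq (mu k) 0.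
  by rewrite invr0 mulr0.
by rewrite mulVf // mul1r.
Qed.

End Resolution.

(** * Projections onto constants and onto functions of mean zero *)

Section MeanProjection.
Variables (R : realFieldType) (n : nat).

(** [meanproj false] averages a vector; [meanproj true = 1 - meanproj false]
    projects onto the vectors with zero sum. *)
Definition meanproj (b : bool) : 'M[R]_n :=
  if b then 1%:M - const_mx n%:R^-1 else const_mx n%:R^-1.

Lemma meanproj_sum : meanproj true + meanproj false = 1%:M.
Proof. exact: subrK. Qed.

Lemma tr_meanproj b : (meanproj b)^T = meanproj b.
Proof. by case: b; rewrite /= ?linearB /= ?trmx1 trmx_const. Qed.

Hypothesis n_gt0 : (0 < n)%N.
Let n_neq0 : n%:R != 0 :> R. Proof. by rewrite pnatr_eq0 -lt0n. Qed.

Lemma meanprojM b c : meanproj b *m meanproj c = (b == c)%:R *: meanproj b.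
Proof.
have QQ : meanproj false *m meanproj false = meanproj false.
  apply/matrixP => i j; rewrite !mxE; under eq_bigr do rewrite !mxE.
  by rewrite sumr_const card_ord -[LHS]mulr_natr mulfVK.
have TE : meanproj true = 1%:M - meanproj false by [].
case: b; case: c; rewrite /= ?scale1r ?scale0r ?TE ?QQ //.
- by rewrite mulmxBl mul1mx mulmxBr mulmx1 QQ subrr subr0.
- by rewrite mulmxBl mul1mx QQ subrr.
- by rewrite mulmxBr mulmx1 QQ subrr.
Qed.

Lemma mxtrace_meanproj b : \tr (meanproj b) = if b then n%:R - 1 else 1.
Proof.
have Q : \tr (meanproj false) = 1.
  rewrite /mxtrace; under eq_bigr do rewrite mxE.
  by rewrite sumr_const card_ord -[LHS]mulr_natr mulVf.
by case: b => //=; rewrite linearB /= mxtrace1 [X in _ - X]Q.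
Qed.

Lemma meanproj_diag b i : meanproj b i i = \tr (meanproj b) / n%:R.
Proof.
rewrite mxtrace_meanproj; case: b; rewrite !mxE ?mul1r //.
by rewrite eqxx mulrBl divff // mul1r.
Qed.

End MeanProjection.

Arguments meanproj : simpl never.

(** * The product of two complete graphs *)

Section CompleteProduct.
Variables (R : rcfType) (n m : nat).
Hypotheses (n_gt0 : (0 < n)%N) (m_gt0 : (0 < m)%N).
Let n_neq0 : n%:R != 0 :> R. Proof. by rewrite pnatr_eq0 -lt0n. Qed.
Let m_neq0 : m%:R != 0 :> R. Proof. by rewrite pnatr_eq0 -lt0n. Qed.

Local Notation G := (cart_graph (complete_graph n) (complete_graph m)).
Local Notation P := (fun k : bool * bool =>
  kmx (meanproj R n k.1) (meanproj R m k.2)).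

Lemma degree_cart_complete p : degree G p = (n.-1 + m.-1)%N.
Proof.
case: p => a b; rewrite /degree.
have -> : [set y | G (a, b) y]
  = setX [set a] [set~ b] :|: setX [set~ a] [set b].
  apply/setP => -[c d]; rewrite !inE /= /cart_adj /= /complete_adj.
  rewrite ![in RHS](eq_sym c) ![in RHS](eq_sym d).
  by case: (a == c); case: (b == d).
rewrite cardsU !cardsX !cards1 !cardsC1 !card_ord mul1n muln1.
rewrite (_ : _ :&: _ = set0) ?cards0 ?subn0 1?addnC //.
by apply/setP => -[c d]; rewrite !inE /=; case: (c == a); rewrite ?andbF.
Qed.

(** The Laplacian eigenvalue on the image of [P k]. *)
Definition cart_eig (k : bool * bool) : R := n%:R *+ k.1 + m%:R *+ k.2.

Lemma sum_bool2 (V : zmodType) (F : bool * bool -> V) :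
  \sum_k F k = F (true, true) + F (true, false)
               + (F (false, true) + F (false, false)).
Proof.
have -> : \sum_k F k = \sum_b \sum_c F (b, c).
  by rewrite pair_bigA; apply: eq_bigr => -[].
by rewrite !big_bool.
Qed.

Lemma cart_proj_sum : \sum_k P k = 1%:M.
Proof. by rewrite sum_bool2 /= -!kmxDr -kmxDl !meanproj_sum kmx1. Qed.

Lemma cart_projM k l : P k *m P l = (k == l)%:R *: P k.
Proof.
case: k l => a b [c d].
by rewrite kmxM !meanprojM //= kmxZl kmxZr scalerA -natrM mulnb.
Qed.

Lemma tr_cart_proj k : (P k)^T = P k.
Proof. by rewrite tr_kmx !tr_meanproj. Qed.

Lemma cart_proj_const : P (false, false) = const_mx (n%:R * m%:R)^-1.
Proof. by apply/matrixP => i j; rewrite !mxE invfM. Qed.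

Lemma laplacian_cart_complete : laplacian R G = \sum_k cart_eig k *: P k.
Proof.
(* The Laplacian of a complete graph on n points is n times meanproj true,
   and the Laplacian of a product is the Kronecker sum of the Laplacians. *)
have -> : \sum_k cart_eig k *: P k
  = n%:R *: kmx (meanproj R n true) 1%:M + m%:R *: kmx 1%:M (meanproj R m true).
  rewrite sum_bool2 /cart_eig /= !mulr0n !mulr1n !addr0 !add0r scale0r addr0.
  rewrite -(meanproj_sum R n) -(meanproj_sum R m)
    (kmxDl (meanproj R n true)) (kmxDr _ (meanproj R m true)).
  by rewrite scalerDl !scalerDr !addrA; congr (_ + _); rewrite addrAC.
apply/matrixP => i j; rewrite !mxE degree_cart_complete.
rewrite -(inj_eq enum_val_inj) /=.
case: (enum_val i) (enum_val j) => a b [c d].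
rewrite /cart_adj /= /complete_adj xpair_eqE natrD -!subn1 !natrB //.
case: (a == c); case: (b == d) => //=; by field; rewrite n_neq0 m_neq0.
Qed.

(** The trace of the Moore-Penrose inverse of the Laplacian; the kernel term
    vanishes because [0^-1 = 0]. *)
Definition kirchhoff_trace : R := \sum_k (cart_eig k)^-1 * \tr (P k).

Lemma kirchhoff_traceE :
  kirchhoff_trace = (n%:R - 1) * (m%:R - 1) / (n%:R + m%:R)
    + (n%:R - 1) / n%:R + (m%:R - 1) / m%:R.
Proof.
rewrite /kirchhoff_trace sum_bool2 /cart_eig /= !mxtrace_kmx.
rewrite !mxtrace_meanproj // !mulr0n !mulr1n !addr0 add0r invr0 mul0r addr0.
rewrite !mul1r !mulr1.
by rewrite ![_^-1 * _]mulrC.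
Qed.

(** For [k = (false, false)], [2 / cart_eig k = 0]. *)
Lemma resistance_cart_complete :
  resistance_mx R G
  = \sum_k (2 * kirchhoff_trace *+ (k == (false, false)) - 2 / cart_eig k)
            *: P k.
Proof.
have mpE := mpinv_resolution cart_projM cart_eig tr_cart_proj.
rewrite -laplacian_cart_complete in mpE.
(* The idempotents have constant diagonals, hence so has the inverse. *)
have dg i : mpinv (laplacian R G) i i = kirchhoff_trace / (n%:R * m%:R).
  rewrite mpE summxE mulr_suml; apply: eq_bigr => k _.
  rewrite mxE [kmx _ _ _ _]mxE !meanproj_diag // mxtrace_kmx invfM -[RHS]mulrA.
  by congr (_ * _); exact: mulrACA.
under eq_bigr do rewrite scalerBl.
rewrite sumrB (bigD1 (false, false)) //=.
rewrite big1 ?addr0 => [|k /negPf->]; last first.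
  by rewrite mulr0n scale0r.
under [X in _ - X]eq_bigr do rewrite -scalerA.
rewrite -scaler_sumr -mpE cart_proj_const.
apply/matrixP => i j; rewrite !mxE !dg; ring.
Qed.

Theorem resistance_energy_cart_complete :
  resistance_energy R G
  = 4 * ((n%:R - 1) * (m%:R - 1) / (n%:R + m%:R)
         + (n%:R - 1) / n%:R + (m%:R - 1) / m%:R).
Proof.
have n1 : 0 <= n%:R - 1 :> R by rewrite subr_ge0 ler1n.
have m1 : 0 <= m%:R - 1 :> R by rewrite subr_ge0 ler1n.
have T0 : 0 <= kirchhoff_trace.
  rewrite kirchhoff_traceE; apply: addr_ge0; [apply: addr_ge0|];
    rewrite divr_ge0 ?mulr_ge0 //.
  exact: addr_ge0.
rewrite -kirchhoff_traceE /resistance_energy resistance_cart_complete.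
pose lam k := 2 * kirchhoff_trace *+ (k == (false, false)) - 2 / cart_eig k.
rewrite (@matrix_energy_resolution _ _ _ _ P lam) ?cart_proj_sum //; first last.
- by move=> k; rewrite mulmx_sum_proj //; apply: cart_projM.
- rewrite raddf_sum; apply: eq_bigr => k _.
  by rewrite /= linearZ /= tr_cart_proj.
have eig0 k : 0 <= cart_eig k by rewrite addr_ge0 // mulrn_wge0.
have normlam k : `|lam k| = 2 * kirchhoff_trace *+ (k == (false, false))
                             + 2 * (cart_eig k)^-1.
  rewrite /lam; have [->|_] := eqVneq k (false, false).
    rewrite /cart_eig !mulr0n addr0 invr0 mulr0 subr0 addr0.
    by rewrite ger0_norm ?mulr_ge0.
  by rewrite mulr0n sub0r add0r normrN ger0_norm // mulr_ge0 ?invr_ge0.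
under eq_bigr do rewrite normlam mulrDl -[X in _ + X]mulrA.
rewrite big_split /= -mulr_sumr -/kirchhoff_trace (bigD1 (false, false)) //=.
rewrite big1 => [|k /negPf->]; last by rewrite mulr0n mul0r.
rewrite mxtrace_kmx !mxtrace_meanproj //=; ring.
Qed.

End CompleteProduct.

Theorem corollary5p5 (R : realType) (n : nat) (hn : (0 < n)%N) :
  resistance_energy R (cart_graph (complete_graph n) (complete_graph 2))
  = (10 * n%:R ^+ 2 + 4 * n%:R - 8) / (n%:R * (n%:R + 2)).
Proof.
rewrite resistance_energy_cart_complete //.
have n_neq0 : n%:R != 0 :> R by rewrite pnatr_eq0 -lt0n.
have n2_neq0 : n%:R + 2 != 0 :> R by rewrite -natrD pnatr_eq0 addn2.
by field; rewrite n_neq0 n2_neq0.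
Qed.
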